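(* Let $n\ge4$ and $k\ge1$ be integers. Then \[ \gamma_{[k]R}(C_7\Box P_n)\le 7(n-2)\left\lceil\frac{k+5}{5}\right\rceil+14\left\lceil\frac{k+3-\left\lceil\frac{k+5}{5}\right\rceil}{3}\right\rceil-(n+2). \]
   Context: For a graph $G$ and $v\in V(G)$, $N(v)$ is the open neighborhood and $N[v]=N(v)\cup\{v\}$. For an integer $k\ge1$, a function $f:V(G)\to\{0,1,\dots,k+1\}$ is a $[k]$-Roman dominating function if for every vertex $v$ with $f(v)<k$ we have $\sum_{u\in N[v]}f(u)\ge k+|\{u\in N(v): f(u)>0\}|$. The weight of $f$ is $\sum_{v}f(v)$, and $\gamma_{[k]R}(G)$ is the minimum weight of a $[k]$-Roman dominating function on $G$. $C_m\Box P_n$ is the Cartesian product of the cycle $C_m$ (vertices $0,\dots,m-1$ mod $m$) and the path $P_n$ (vertices $0,\dots,n-1$): $(i,j)\sim(i',j')$ iff ($i=i'$ and $|j-j'|=1$) or ($j=j'$ and $i'\equiv i\pm1 \pmod m$). *)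

(* Defs.v *)
From mathcomp Require Import all_boot all_order all_algebra.

Set Implicit Arguments.
Unset Strict Implicit.
Unset Printing Implicit Defensive.

Local Open Scope nat_scope.

(* A graph is given by its adjacency relation e on a finite vertex type V. *)

Definition neigh (V : finType) (e : rel V) (v : V) : {set V} :=
  [set u | e v u].

Definition cl_neigh (V : finType) (e : rel V) (v : V) : {set V} :=
  v |: neigh e v.

Definition kroman_dominating (V : finType) (e : rel V) (k : nat)
    (f : {ffun V -> 'I_k.+2}) : bool :=
  [forall v : V, (f v < k) ==>
    (k + #|[set u in neigh e v | 0 < f u]| <= \sum_(u in cl_neigh e v) f u)].

Definition weight (V : finType) (k : nat) (f : {ffun V -> 'I_k.+2}) : nat :=
  \sum_(v : V) f v.

(* The constant function k+1 only serves to witness that the minimum is over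
   a nonempty family; see kroman_dominating_max. *)
Definition kroman_number (V : finType) (e : rel V) (k : nat) : nat :=
  weight [arg min_(f < [ffun=> ord_max] | @kroman_dominating V e k f)
            weight f].

Definition cycle_rel (m : nat) : rel 'I_m :=
  fun i j => (j == i + 1 %[mod m]) || (i == j + 1 %[mod m]).

Definition path_rel (n : nat) : rel 'I_n :=
  fun i j => (j == i + 1 :> nat) || (i == j + 1 :> nat).

Definition cart_prod (V W : finType) (e : rel V) (e' : rel W) : rel (V * W) :=
  fun x y => ((x.1 == y.1) && e' x.2 y.2) || ((x.2 == y.2) && e x.1 y.1).

Lemma kroman_dominating_max (V : finType) (e : rel V) (k : nat) :
  @kroman_dominating V e k [ffun=> ord_max].
Proof. by apply/forallP=> v; rewrite ffunE /= ltnNge leqnSn. Qed.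

Lemma kroman_numberP (V : finType) (e : rel V) (k : nat) :
  (exists2 f : {ffun V -> 'I_k.+2},
     kroman_dominating e f & weight f = kroman_number e k) /\
  (forall f : {ffun V -> 'I_k.+2},
     kroman_dominating e f -> kroman_number e k <= weight f).
Proof.
rewrite /kroman_number; case: arg_minnP; first exact: kroman_dominating_max.
by move=> f fP fmin; split=> //; exists f.
Qed.

Lemma cycle_rel_sym m : symmetric (@cycle_rel m).
Proof. by move=> i j; rewrite /cycle_rel orbC. Qed.

Lemma cycle_rel_irr m : 1 < m -> irreflexive (@cycle_rel m).
Proof.
move=> m1 i; rewrite /cycle_rel orbb -{1}[nat_of_ord i]addn0 eqn_modDl.
by rewrite mod0n modn_small.
Qed.

Lemma path_rel_sym n : symmetric (@path_rel n).
Proof. by move=> i j; rewrite /path_rel orbC. Qed.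

Lemma path_rel_irr n : irreflexive (@path_rel n).
Proof. by move=> i; rewrite /path_rel orbb addn1 ltn_eqF. Qed.

Lemma cart_prod_sym (V W : finType) (e : rel V) (e' : rel W) :
  symmetric e -> symmetric e' -> symmetric (cart_prod e e').
Proof.
by move=> se se' x y; rewrite /cart_prod se se' (eq_sym y.1) (eq_sym y.2).
Qed.

Lemma cart_prod_irr (V W : finType) (e : rel V) (e' : rel W) :
  irreflexive e -> irreflexive e' -> irreflexive (cart_prod e e').
Proof. by move=> ie ie' x; rewrite /cart_prod ie ie' !andbF. Qed.

(* Main.v *)
(** Write [a] and [b] for the two ceilings. The function equal to [b] on the two
    boundary columns and to [a] on the others satisfies the domination inequality
    with slack 0 on the boundary columns, [s >= (k + 10) / 15] on the columns next
    to them and 1 elsewhere, so it can be improved by an integer perturbation [h]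
    whose sums over closed neighbourhoods are at least minus these slacks: one
    decrement per inner column, drifting by three rows from a column to the next,
    while at each end raising two boundary values pays for further decrements.
    A perturbation of sum [- (n + 2)] exists for [s = 2] if [n >= 10] and for
    [s = 3] if [4 <= n <= 9]. For [k <= 5] the value [k + 1] on a dominating set
    with two vertices per column is enough. What remains is [n <= 9] and [k] among
    9, 10, 15, 20: there small dominating sets do, except in five cases
    [(n, k)] = (6, 15), (5, 20), (6, 20), (7, 20), (8, 20), where functions found
    by computer search are used. *)

Require Import Defs.
From mathcomp Require Import all_boot all_order all_algebra.
From mathcomp Require Import zify.

Set Implicit Arguments.
Unset Strict Implicit.
Unset Printing Implicit Defensive.

Import Order.TTheory GRing.Theory Num.Theory.

(** * Neighbourhood sums in the cylinder *)

Lemma sum_ord7_rot (G : nat -> nat) (c : nat) :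
  \sum_(i < 7) G ((i + c) %% 7) = \sum_(i < 7) G i.
Proof.
rewrite [RHS](reindex_inj (addIr (inZp c : 'I_7))).
by apply: eq_bigr => i _; rewrite /= modnDmr.
Qed.

Lemma sum_cycle7 (G : nat -> nat) (i : 'I_7) :
  \sum_(j | cycle_rel i j) G j = G ((i + 1) %% 7) + G ((i + 6) %% 7).
Proof.
rewrite big_mkcond !big_ord_recl big_ord0 /cycle_rel.
by case: i => [[|[|[|[|[|[|[|//]]]]]]] Hi] //=;
  rewrite /bump !(add0n, addn0) // addnC.
Qed.

(** Columns are shifted by one so that the zeros at [0] and [n.+1] stand for the missing neighbours
    of the two ends of the path. *)
Lemma sum_path (n : nat) (G : nat -> nat) (j : 'I_n) :
  G 0 = 0 -> G n.+1 = 0 ->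
  \sum_(l | path_rel j l) G l.+1 = G j + G j.+2.
Proof.
move=> G0 Gn; rewrite (bigID (fun l : 'I_n => l == j + 1 :> nat)) /= addnC.
congr (_ + _).
  rewrite (eq_bigl (fun l : 'I_n => (0 < j) && (l == j.-1 :> nat))); last first.
    by move=> l; rewrite /path_rel; lia.
  have [j0|j0] := posnP j; first by rewrite j0 G0 big_pred0.
  rewrite /= (@big_ord1_eq _ _ _ (fun l => G l.+1)) prednK //.
  by case: ifP => //; have := ltn_ord j; lia.
rewrite (eq_bigl (fun l : 'I_n => l == j.+1 :> nat)); last first.
  by move=> l; rewrite /path_rel; lia.
rewrite (@big_ord1_eq _ _ _ (fun l => G l.+1)).
case: ifP => // H; suff -> : j.+2 = n.+1 by [].
by have := ltn_ord j; lia.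
Qed.

Lemma sum_neigh (n : nat) (G : nat -> nat -> nat) (i : 'I_7) (j : 'I_n) :
  (forall r, G r 0 = 0) -> (forall r, G r n.+1 = 0) ->
  \sum_(u in neigh (cart_prod (@cycle_rel 7) (@path_rel n)) (i, j))
     G u.1 u.2.+1 =
  G ((i + 1) %% 7) j.+1 + G ((i + 6) %% 7) j.+1 + G i j + G i j.+2.
Proof.
move=> G0 Gn.
rewrite (eq_bigl (cart_prod (@cycle_rel 7) (@path_rel n) (i, j))); last first.
  by move=> u; rewrite inE.
rewrite -addnA -(sum_cycle7 (fun r => G r j.+1)) -(sum_path j (G0 i) (Gn i)).
rewrite (bigID (fun u => u.1 == i)) /= addnC; congr (_ + _).
  rewrite (eq_bigl (fun u : 'I_7 * 'I_n => cycle_rel i u.1 && (u.2 == j))).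
    rewrite -(pair_big (cycle_rel i) (pred1 j) (fun r l => G r (nat_of_ord l).+1)) /=.
    by apply: eq_bigr => r _; rewrite big_pred1_eq.
  move=> [r l]; rewrite /cart_prod /= (eq_sym i r) (eq_sym j l).
  have [->|_] /= := eqVneq r i; last by rewrite andbT andbC.
  by rewrite andbF cycle_rel_irr.
rewrite (eq_bigl (fun u : 'I_7 * 'I_n => (u.1 == i) && path_rel j u.2)).
  rewrite -(pair_big (pred1 i) (path_rel j) (fun r l => G (nat_of_ord r) l.+1)) /=.
  by rewrite big_pred1_eq.
move=> [r l]; rewrite /cart_prod /= (eq_sym i r).
have [->|_] /= := eqVneq r i; last by rewrite andbF.
by rewrite cycle_rel_irr // andbF orbF andbT.
Qed.

(** * Upper bounds from tables of values *)

Definition roman_ok (k c : nat) (s : seq nat) : bool :=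
  (k <= c) || (k + count (ltn 0) s <= c + sumn s).

(* [F j r] is the value in the [j]-th column, columns being numbered from 1 and
   padded with zero columns [0] and [n.+1]; the row index of column [j] is
   rotated by [d * j], so that a pattern drifting by [d] rows per column
   becomes constant. Rotation by [- d] is written [6 * d]. *)
Lemma kroman_number_le_table (n k d : nat) (F : nat -> nat -> nat) :
  (forall r, F 0 r = 0) -> (forall r, F n.+1 r = 0) ->
  (forall j r, F j r <= k.+1) ->
  (forall j r, 0 < j <= n -> r < 7 ->
     roman_ok k (F j r) [:: F j ((r + 1) %% 7); F j ((r + 6) %% 7);
       F j.-1 ((r + 6 * d) %% 7); F j.+1 ((r + d) %% 7)]) ->
  kroman_number (cart_prod (@cycle_rel 7) (@path_rel n)) k
    <= \sum_(j < n) \sum_(r < 7) F j.+1 r.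
Proof.
move=> F0 Fn Fle Fok; set e := cart_prod _ _.
pose G r j := F j ((r + d * j) %% 7).
have GE (u : 'I_7 * 'I_n) : (inord (G u.1 u.2.+1) : 'I_k.+2) = G u.1 u.2.+1 :> nat.
  by rewrite inordK // ltnS Fle.
pose f := [ffun u : 'I_7 * 'I_n => (inord (G u.1 u.2.+1) : 'I_k.+2)].
have fE u : f u = G u.1 u.2.+1 :> nat by rewrite ffunE GE.
have fP : kroman_dominating e f.
  apply/forallP => -[i j]; apply/implyP.
  have e_irr : irreflexive e.
    by apply: cart_prod_irr; [apply: cycle_rel_irr|apply: path_rel_irr].
  rewrite /cl_neigh big_setU1 ?inE ?e_irr //=.
  under eq_bigr do rewrite fE.
  rewrite (@sum_neigh n G) ?fE /=; last 2 first.
  - by move=> r; apply: F0.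
  - by move=> r; apply: Fn.
  (* The number of positive neighbours is itself a neighbourhood sum, that of an indicator, so
     [sum_neigh] evaluates it too. *)
  have -> : #|[set u in neigh e (i, j) | 0 < f u]| =
      \sum_(u in neigh e (i, j)) (0 < G u.1 u.2.+1).
    rewrite -sum1_card big_mkcond [RHS]big_mkcond; apply: eq_bigr => u _.
    by rewrite inE fE; case: (u \in _).
  rewrite (@sum_neigh n (fun r l => nat_of_bool (0 < G r l))); last 2 first.
  - by move=> r; rewrite /G F0.
  - by move=> r; rewrite /G Fn.
  have jn : 0 < j.+1 <= n := ltn_ord j.
  have rlt : (i + d * j.+1) %% 7 < 7 by rewrite ltn_mod.
  have := Fok _ _ jn rlt; rewrite /roman_ok /= !addn0.
  have e1 t : F j.+1 (((i + d * j.+1) %% 7 + t) %% 7) = G ((i + t) %% 7) j.+1.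
    by rewrite /G !modnDml addnAC.
  have e2 : F j.+2 (((i + d * j.+1) %% 7 + d) %% 7) = G i j.+2.
    by rewrite /G modnDml; congr (F _ (_ %% _)); lia.
  have e3 : F j (((i + d * j.+1) %% 7 + 6 * d) %% 7) = G i j.
    rewrite /G modnDml; congr (F _ _).
    have -> : i + d * j.+1 + 6 * d = d * 7 + (i + d * j) by lia.
    by rewrite modnMDl.
  by rewrite !e1 e2 e3 -/(G i j.+1); lia.
apply: leq_trans ((kroman_numberP e k).2 f fP) _; rewrite /weight.
under eq_bigr do rewrite fE.
rewrite -(pair_bigA _ (fun r (l : 'I_n) => G (nat_of_ord r) l.+1)) exchange_big /=.
by apply: leq_sum => j _; rewrite -(sum_ord7_rot (F j.+1) (d * j.+1)).
Qed.

(** In each column, rotated rows 0 and 3 dominate all rows but 5. With drift 5, row 5 is adjacent to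
    row 0 of the previous column and to row 3 of the next one, and [1 < n] provides one of them. *)
Lemma kroman_number_le_small (n k : nat) :
  1 < n ->
  kroman_number (cart_prod (@cycle_rel 7) (@path_rel n)) k <= 2 * n * k.+1.
Proof.
move=> n1.
pose F (j r : nat) := if (0 < j <= n) && ((r == 0) || (r == 3)) then k.+1 else 0.
have Fle j r : F j r <= k.+1 by rewrite /F; case: ifP.
have F0 r : F 0 r = 0 by [].
have Fn r : F n.+1 r = 0 by rewrite /F ltnn.
apply: leq_trans (@kroman_number_le_table n k 5 F F0 Fn Fle _) _.
- move=> j r jn r7; rewrite /roman_ok /= /F jn.
  case: r r7 => [|[|[|[|[|[|[|//]]]]]]] _; rewrite ?ltnn ?leqnSn /=; try lia.
  rewrite (_ : (5 + 5) %% 7 == 3) // !andbT.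
  have : (0 < j.-1 <= n) || (j < n) by lia.
  by case: (0 < j.-1 <= n); case: (j < n) => //= _; lia.
rewrite (eq_bigr (fun=> 2 * k.+1)); last first.
  by move=> j _; rewrite !big_ord_recl big_ord0 /F ltn_ord /=; lia.
by rewrite sum_nat_const card_ord; lia.
Qed.

(** The empty column in front makes numbering start at 1; both padding columns then come from
    default values. *)
Definition pad (T : Type) (x0 : T) (cols : seq (seq T)) (j r : nat) : T :=
  nth x0 (nth [::] ([::] :: cols) j) r.

Lemma big_pad (T : Type) (op : T -> T -> T) (x0 : T) (cols : seq (seq T)) :
  all (fun c => size c == 7) cols ->
  \big[op/x0]_(j < size cols) \big[op/x0]_(r < 7) pad x0 cols j.+1 r =
  \big[op/x0]_(c <- cols) \big[op/x0]_(x <- c) x.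
Proof.
move=> /(all_nthP [::]) c7; rewrite [RHS](big_nth [::]) big_mkord.
apply: eq_bigr => j _; rewrite [RHS](big_nth x0) big_mkord.
by rewrite (eqP (c7 _ (ltn_ord j))).
Qed.

Lemma pad0 (T : Type) (x0 : T) cols r : pad x0 cols 0 r = x0.
Proof. exact: nth_nil. Qed.

Lemma pad_last (T : Type) (x0 : T) cols r : pad x0 cols (size cols).+1 r = x0.
Proof. by rewrite /pad (nth_default [::]) ?nth_nil /=. Qed.

Lemma pad_all (T : Type) (x0 : T) (P : pred T) cols j r :
  P x0 -> all (all P) cols -> P (pad x0 cols j r).
Proof.
move=> P0 Pc; rewrite /pad.
have /(all_nthP [::]) H : all (all P) ([::] :: cols) by [].
have [jlt|jge] := ltnP j (size ([::] :: cols)); last first.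
  by rewrite (nth_default [::] jge) nth_nil.
have [rlt|rge] := ltnP r (size (nth [::] ([::] :: cols) j)); last first.
  by rewrite nth_default.
move: (H _ jlt) => /(all_nthP x0) Hr; exact: Hr.
Qed.

Definition cols_ok (k : nat) (cols : seq (seq nat)) : bool :=
  let F := pad 0 cols in
  [&& all (fun c => size c == 7) cols, all (all (fun x => x <= k.+1)) cols &
   all (fun j => all (fun r => roman_ok k (F j r)
     [:: F j ((r + 1) %% 7); F j ((r + 6) %% 7); F j.-1 r; F j.+1 r])
     (iota 0 7)) (iota 1 (size cols))].

Lemma kroman_number_le_cols (n k w : nat) (cols : seq (seq nat)) :
  cols_ok k cols -> size cols = n -> \sum_(c <- cols) \sum_(x <- c) x <= w ->
  kroman_number (cart_prod (@cycle_rel 7) (@path_rel n)) k <= w.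
Proof.
move=> /and3P[c7 cle /allP ok] <-; apply: leq_trans.
rewrite -(big_pad addn 0 c7); apply: (@kroman_number_le_table _ _ 0).
- exact: pad0.
- exact: pad_last.
- by move=> j r; apply: (pad_all (P := fun x => x <= k.+1)).
move=> j r jn r7; rewrite muln0 addn0 (modn_small r7).
have jI : j \in iota 1 (size cols) by rewrite mem_iota; lia.
by have /allP := ok _ jI; apply; rewrite mem_iota.
Qed.

(** * Perturbing the function with values [a] and [b] *)

Definition slack (n s j : nat) : nat :=
  if (j == 1) || (j == n) then 0 else if (j == 2) || (j == n.-1) then s else 1.

Definition slack_ok (n s d : nat) (H : nat -> nat -> int) (j r : nat) : bool :=
  let r1 := (r + 1) %% 7 in let r2 := (r + 6) %% 7 in
  let r3 := (r + 6 * d) %% 7 in let r4 := (r + d) %% 7 in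
  (0 <= (slack n s j)%:Z + H j r + H j r1 + H j r2 + H j.-1 r3 + H j.+1 r4)%R.

(* The hypotheses on [a] and [b] say that the function equal to [b] on the two
   boundary columns and to [a] elsewhere satisfies the domination inequality
   with slack 0, [s] and 1 on boundary, next-to-boundary and other columns. *)
Lemma kroman_number_le_perturb (n k d a b s : nat) (H : nat -> nat -> int) :
  3 < n -> 1 < a <= k -> 1 < b <= k ->
  k + 3 <= 3 * b + a -> k + 4 + s <= b + 4 * a -> k + 5 <= 5 * a ->
  (forall r, H 0 r = 0%R) -> (forall r, H n.+1 r = 0%R) ->
  (forall j r, (-2 <= H j r)%R && (H j r <= 1)%R) ->
  (forall j r, 0 < j <= n -> r < 7 -> slack_ok n s d H j r) ->
  ((kroman_number (cart_prod (@cycle_rel 7) (@path_rel n)) k)%:Z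
   <= 7 * (n%:Z - 2) * a%:Z + 14 * b%:Z
      + \sum_(j < n) \sum_(r < 7) H j.+1 r)%R.
Proof.
move=> n4 a2 b2 k0 k1 k2 H0 Hn Hb Hok.
pose base (j : nat) := if (j == 1) || (j == n) then b else a.
(* The absolute value is only a cast: [a] and [b] are at least 2 and [H] is at least -2. *)
pose F j r := if 0 < j <= n then `|((base j)%:Z + H j r)%R|%N else 0.
have FE j r : 0 < j <= n -> ((F j r)%:Z = (base j)%:Z + H j r)%R.
  by move=> jn; rewrite /F jn /base; have := Hb j r; case: ifP; lia.
have Fle j r : F j r <= k.+1.
  have [jn|jn] := boolP (0 < j <= n); last by rewrite /F (negbTE jn).
  by have := FE j r jn; have := Hb j r; rewrite /base; case: ifP; lia.
have F0 r : F 0 r = 0 by [].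
have Fn r : F n.+1 r = 0 by rewrite /F ltnn.
have le_table := @kroman_number_le_table n k d F F0 Fn Fle.
have wE : ((\sum_(j < n) \sum_(r < 7) F j.+1 r)%N%:Z =
  7 * (n%:Z - 2) * a%:Z + 14 * b%:Z + \sum_(j < n) \sum_(r < 7) H j.+1 r)%R.
  rewrite -!natz natr_sum.
  transitivity (\sum_(j < n) (7 * (base j.+1)%:Z + \sum_(r < 7) H j.+1 r))%R.
    apply: eq_bigr => j _; rewrite natr_sum.
    under eq_bigr => r _ do rewrite natz (FE j.+1 r (ltn_ord j)).
    by rewrite big_split /= sumr_const card_ord mulr_natl.
  rewrite big_split /=; congr (_ + _)%R.
  case: n n4 {Hn Hok FE Fle le_table F Fn F0} @base => [|[|m]] // n4 base.
  rewrite big_ord_recl big_ord_recr /= /base /= eqxx.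
  rewrite (eq_bigr (fun=> (7 * a%:Z)%R)); last first.
    move=> j _; rewrite /bump /=; case: eqP => // jm; have := ltn_ord j; lia.
  by rewrite sumr_const card_ord -mulr_natl; lia.
rewrite -wE lez_nat; apply: le_table.
move=> j r jn r7; have := Hok j r jn r7.
(* The count of positive neighbours is at most 3 on boundary columns and 4 elsewhere; the hypotheses
   on [a] and [b] cover this count plus the slack. *)
rewrite /slack_ok /roman_ok /= !addn0 => Hs; apply/orP; right.
set r1 := (r + 1) %% 7 in Hs *; set r2 := (r + 6) %% 7 in Hs *.
set r3 := (r + 6 * d) %% 7 in Hs *; set r4 := (r + d) %% 7 in Hs *.
have := Hb j r; have := Hb j r1; have := Hb j r2.
have := Hb j.-1 r3; have := Hb j.+1 r4.
have := H0 r3; have := Hn r4; have := F0 r3; have := Fn r4.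
have := FE j r jn; have := FE j r1 jn; have := FE j r2 jn.
move: Hs; rewrite /slack.
have [j1|j1] := eqVneq j 1.
  have jn' : 0 < j.+1 <= n by lia.
  have := FE _ r4 jn'; rewrite /base j1 /= (_ : 2 == n = false); last by lia.
  lia.
have [jE|jE] := eqVneq j n.
  have jn' : 0 < j.-1 <= n by lia.
  have := FE _ r3 jn'; rewrite /base jE eqxx orbT.
  rewrite (_ : ((n.-1 == 1) || (n.-1 == n)) = false); last by lia.
  rewrite orbT; lia.
have j'n : 0 < j.-1 <= n by lia.
have j''n : 0 < j.+1 <= n by lia.
have := FE _ r3 j'n; have := FE _ r4 j''n; rewrite /base.
rewrite (negbTE j1) (negbTE jE) /=.
have -> : (j.+1 == 1) = false by lia.
have -> : (j.+1 == n) = (j == n.-1) by lia.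
have -> : (j.-1 == 1) = (j == 2) by lia.
have -> : (j.-1 == n) = false by lia.
have [j2|j2] := eqVneq j 2; have [j3|j3] := eqVneq j n.-1; rewrite /=; lia.
Qed.

Definition perturb_ok (s d : nat) (cols : seq (seq int)) : bool :=
  [&& all (fun c => size c == 7) cols,
   all (all (fun x => (-2 <= x)%R && (x <= 1)%R)) cols &
   all (fun j => all (slack_ok (size cols) s d (pad 0%R cols) j) (iota 0 7))
     (iota 1 (size cols))].

Lemma perturb_ok_slack s d cols j r :
  perturb_ok s d cols -> 0 < j <= size cols -> r < 7 ->
  slack_ok (size cols) s d (pad 0%R cols) j r.
Proof.
move=> /and3P[_ _ /allP ok] jn r7.
have jI : j \in iota 1 (size cols) by rewrite mem_iota; lia.
by have /allP := ok _ jI; apply; rewrite mem_iota.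
Qed.

Lemma kroman_number_le_perturb_cols (n k d a b s : nat) (cols : seq (seq int)) :
  3 < n -> 1 < a <= k -> 1 < b <= k ->
  k + 3 <= 3 * b + a -> k + 4 + s <= b + 4 * a -> k + 5 <= 5 * a ->
  perturb_ok s d cols -> size cols = n ->
  (\sum_(c <- cols) \sum_(x <- c) x = - (n%:Z + 2))%R ->
  ((kroman_number (cart_prod (@cycle_rel 7) (@path_rel n)) k)%:Z
   <= 7 * (n%:Z - 2) * a%:Z + 14 * b%:Z - (n%:Z + 2))%R.
Proof.
move=> n4 a2 b2 k0 k1 k2 ok szE sumE; case/and3P: (ok) => c7 cb _.
rewrite -sumE -(big_pad _ _ c7) szE.
apply: (kroman_number_le_perturb (d := d) n4 a2 b2 k0 k1 k2).
- exact: pad0.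
- by move=> r; rewrite -szE pad_last.
- by move=> j r; exact: (@pad_all _ _ (fun x : int => (-2 <= x <= 1)%R) _ j r _ cb).
by rewrite -szE => j r jn r7; apply: (perturb_ok_slack ok jn r7).
Qed.

(* Once three consecutive copies of [c] are present, every window of three
   consecutive columns of the longer word already occurs in the shorter one. *)
Lemma perturb_ok_nseq (s d m : nat) (st en : seq (seq int)) (c : seq int) :
  0 < size st -> 0 < size en -> 2 < m ->
  perturb_ok s d (st ++ nseq m c ++ en) ->
  perturb_ok s d (st ++ nseq m.+1 c ++ en).
Proof.
move=> st0 en0 m2; set W := fun m => st ++ nseq m c ++ en.
have nthW l j : nth [::] (W l) j = if j < size st then nth [::] st j
    else if j < size st + l then c else nth [::] en (j - (size st + l)).
  rewrite /W !nth_cat size_nseq nth_nseq subnDA; case: ltnP => // jst.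
  by rewrite (_ : (j - size st < l) = (j < size st + l)); [case: (j < _) | lia].
have szW l : size (W l) = size st + l + size en.
  by rewrite !size_cat size_nseq addnA.
have padl j r : j <= size st + m -> pad 0%R (W m.+1) j r = pad 0%R (W m) j r.
  case: j => // j jm; rewrite /pad /= !nthW.
  by do 4?case: ifP => //; lia.
have padr j r : size st + 1 < j -> pad 0%R (W m.+1) j r = pad 0%R (W m) j.-1 r.
  case: j => [|[|j]] jm; [lia..|rewrite /pad /= !nthW].
  rewrite (_ : j.+1 - (size st + m.+1) = j - (size st + m)); last by lia.
  by do 4?case: ifP => //; lia.
rewrite -/(W m) -/(W m.+1) => ok; case/and3P: (ok) => c7 cb _.
have c7c : (size c == 7) && all (fun x : int => (-2 <= x <= 1)%R) c.
  have cin : c \in W m.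
    by rewrite !mem_cat mem_nseq eqxx (ltnW (ltnW m2)) orbT.
  by rewrite (allP c7 c cin) (allP cb c cin).
have allW (P : pred (seq int)) : P c -> all P (W m) -> all P (W m.+1).
  by rewrite !all_cat /= => -> /and3P[-> -> ->].
apply/and3P; split; [by apply: allW => //; case/andP: c7c..|].
apply/allP => j; rewrite mem_iota => jn; apply/allP => r.
rewrite mem_iota /= => r7; rewrite szW in jn.
(* Either the window around [j] lies where both words agree, or, since [2 < m], it lies where the
   longer word is the shorter one shifted by one. Slacks match because [st] and [en] are
   nonempty. *)
have [jm|jm] := ltnP j (size st + m).
  have jW : 0 < j <= size (W m) by rewrite szW; lia.
  have := perturb_ok_slack ok jW r7; rewrite /slack_ok !padl; try lia.
  suff -> : slack (size (W m)) s j = slack (size (W m.+1)) s j by [].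
  by rewrite /slack !szW; do 4?case: ifP => //; lia.
have jW : 0 < j.-1 <= size (W m) by rewrite szW; lia.
have := perturb_ok_slack ok jW r7; rewrite /slack_ok !padr; try lia.
rewrite prednK; last by lia.
suff -> : slack (size (W m)) s j.-1 = slack (size (W m.+1)) s j by [].
by rewrite /slack !szW; do 4?case: ifP => //; lia.
Qed.

(** * Drifting perturbations for [n >= 10] *)

Definition drift_start : seq (seq int) :=
  [:: [:: 0; 1; 0; 0; 0; 1; 0];
      [:: 0; -1; -1; -1; 0; -1; -1];
      [:: 0; 0; 0; 0; 0; 0; 0];
      [:: 0; -1; 0; 0; 0; -1; 0]]%R.

(** With [d = 4], index 0 of column [j] is row [3 * j] modulo 7. Offsets -3, -1, 0, 1, 3 are
    distinct modulo 7, so along these columns a closed neighbourhood meets at most one decrement. *)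
Definition drift_mid : seq int := [:: -1; 0; 0; 0; 0; 0; 0]%R.

Definition drift_end : seq (seq int) :=
  [:: [:: 0; 0; -1; 0; 0; 0; -1];
      [:: 0; 0; 0; 0; 0; 0; 0];
      [:: 0; -1; -1; 0; -1; -1; -1];
      [:: 0; 0; 1; 0; 0; 0; 1]]%R.

Definition drift_cols (m : nat) : seq (seq int) :=
  drift_start ++ nseq m drift_mid ++ drift_end.

Lemma drift_cols_ok (m : nat) : 1 < m -> perturb_ok 2 4 (drift_cols m).
Proof.
(* Two copies, needed for [n = 10], are checked by computation; [perturb_ok_nseq] applies from three
   copies on. *)
case: m => [|[|[|m]]] // _.
elim: m => [|m IHm]; first by vm_compute.
exact: perturb_ok_nseq IHm.
Qed.

Lemma size_drift_cols (m : nat) : size (drift_cols m) = m + 8.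
Proof. by rewrite !size_cat size_nseq /=; lia. Qed.

Lemma sum_drift_cols (m : nat) :
  (\sum_(c <- drift_cols m) \sum_(x <- c) x = - (m%:Z + 10))%R.
Proof.
rewrite !big_cat big_nseq /= !big_cons !big_nil iter_addr.
by rewrite !(addr0, add0r); lia.
Qed.

(** * Explicit tables for [4 <= n <= 9] *)

Definition perturb_tables : seq (seq (seq int)) :=
  [:: [:: [:: 0; 1; 0; 0; 1; 0; 0];
          [:: -1; -1; -1; 0; -1; -1; 0];
          [:: -1; -1; -1; 0; -1; -1; 0];
          [:: 0; 1; 0; 0; 1; 0; 0]];
      [:: [:: 0; 1; 1; 0; 0; 0; 1];
          [:: -1; -2; -2; -1; 0; -1; -1];
          [:: 1; 1; 1; 0; 0; 0; 0];
          [:: -2; -2; -1; -1; -1; 0; -1];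
          [:: 1; 1; 0; 0; 1; 0; 0]];
      [:: [:: 0; 1; 0; 0; 1; 0; 0];
          [:: -1; -1; -1; -1; -1; -1; 0];
          [:: 0; 0; 0; 0; 0; 0; 0];
          [:: 0; 0; 0; 0; 0; 0; 0];
          [:: -1; -1; -1; -1; -1; -1; 0];
          [:: 0; 1; 0; 0; 1; 0; 0]];
      [:: [:: 0; 1; 0; 0; 1; 0; 0];
          [:: -1; -1; -1; -1; -1; -1; 0];
          [:: 0; 0; 0; 0; 0; 0; 0];
          [:: 0; 0; 0; 0; 0; 0; -1];
          [:: 0; 0; 0; 0; 0; 0; 0];
          [:: -1; -1; -1; -1; -1; -1; 0];
          [:: 0; 1; 0; 0; 1; 0; 0]];
      [:: [:: 0; 1; 0; 0; 1; 0; 0];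
          [:: -1; -1; -1; -1; -1; -1; 0];
          [:: 0; 0; 0; 0; 0; 0; 0];
          [:: 0; 0; 0; 0; 0; 0; -1];
          [:: 0; 0; -1; 0; 0; 0; 0];
          [:: 0; 0; 0; 0; 0; 0; 0];
          [:: -1; -1; 0; -1; -1; -1; -1];
          [:: 1; 0; 0; 0; 1; 0; 0]];
      [:: [:: 0; 1; 0; 0; 1; 0; 0];
          [:: -1; -1; -1; -1; -1; -1; 0];
          [:: 0; 0; 0; 0; 0; 0; 0];
          [:: 0; 0; 0; 0; 0; 0; -1];
          [:: 0; 0; -1; 0; 0; 0; 0];
          [:: 0; 0; 0; 0; 0; -1; 0];
          [:: 0; 0; 0; 0; 0; 0; 0];
          [:: -1; -1; -1; -1; -1; 0; -1];
          [:: 1; 0; 0; 1; 0; 0; 0]]]%R.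

Lemma perturb_tables_ok (n : nat) : 3 < n < 10 ->
  let cols := nth [::] perturb_tables (n - 4) in
  [/\ perturb_ok 3 0 cols, size cols = n &
   (\sum_(c <- cols) \sum_(x <- c) x = - (n%:Z + 2))%R].
Proof.
by case: n => [|[|[|[|[|[|[|[|[|[|n]]]]]]]]]] //= _;
  split; rewrite ?unlock; vm_compute.
Qed.

(** Row indices, column by column, for [n] from 4 to 9; the sets have 7, 9, 11, 12, 14 and 15
    vertices. *)
Definition dominating_sets : seq (seq (seq nat)) :=
  [:: [:: [:: 0; 2]; [:: 4; 5]; [:: 1]; [:: 3; 6]];
      [:: [:: 0; 2]; [:: 4; 5]; [:: 1]; [:: 3; 6]; [:: 1; 4]];
      [:: [:: 0; 2; 4]; [:: 0]; [:: 3; 5]; [:: 0; 1]; [:: 4]; [:: 2; 6]];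
      [:: [:: 0; 2]; [:: 4; 5]; [:: 1]; [:: 3; 6]; [:: 1]; [:: 4; 5];
          [:: 0; 2]];
      [:: [:: 0; 2; 4]; [:: 0]; [:: 3; 5]; [:: 1]; [:: 4; 6]; [:: 1; 2];
          [:: 5]; [:: 0; 3]];
      [:: [:: 1; 5]; [:: 3]; [:: 0; 6]; [:: 2; 4]; [:: 6]; [:: 1; 3];
          [:: 5; 6]; [:: 2]; [:: 0; 4]]].

(** In the five listed cases, [k.+1] times the size of the dominating set exceeds the bound, for
    instance 252 against 250 for [n = 7] and [k = 20]. *)
Definition sporadic_cols (n k : nat) : seq (seq nat) :=
  match n, k with
  | 6, 15 =>
    [:: [:: 0; 0; 12; 4; 0; 4; 12];
        [:: 6; 5; 0; 0; 11; 0; 0];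
        [:: 6; 8; 0; 3; 7; 9; 0];
        [:: 0; 0; 10; 10; 0; 0; 11];
        [:: 1; 2; 0; 6; 0; 0; 14];
        [:: 0; 16; 1; 0; 12; 4; 0]]
  | 5, 20 =>
    [:: [:: 7; 0; 9; 12; 0; 8; 7];
        [:: 9; 7; 0; 0; 7; 7; 0];
        [:: 3; 6; 7; 5; 8; 0; 6];
        [:: 0; 0; 8; 7; 3; 3; 13];
        [:: 7; 14; 0; 0; 15; 4; 0]]
  | 6, 20 =>
    [:: [:: 0; 20; 1; 0; 11; 10; 0];
        [:: 4; 0; 0; 11; 0; 0; 13];
        [:: 5; 0; 11; 10; 0; 3; 9];
        [:: 6; 9; 3; 0; 10; 10; 0];
        [:: 4; 12; 0; 0; 11; 2; 0];
        [:: 0; 0; 10; 11; 0; 0; 20]]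
  | 7, 20 =>
    [:: [:: 9; 0; 14; 1; 8; 10; 0];
        [:: 12; 0; 7; 2; 4; 4; 4];
        [:: 0; 6; 0; 10; 6; 3; 5];
        [:: 0; 15; 0; 8; 0; 6; 12];
        [:: 0; 7; 0; 9; 5; 3; 6];
        [:: 10; 0; 8; 0; 6; 4; 2];
        [:: 10; 0; 15; 0; 8; 9; 2]]
  | 8, 20 =>
    [:: [:: 1; 10; 11; 0; 0; 17; 4];
        [:: 8; 0; 0; 12; 5; 0; 0];
        [:: 14; 8; 0; 5; 5; 0; 11];
        [:: 0; 4; 10; 0; 9; 8; 0];
        [:: 8; 0; 11; 0; 0; 10; 4];
        [:: 12; 0; 0; 11; 4; 3; 2];
        [:: 0; 12; 0; 10; 5; 5; 5];
        [:: 0; 11; 0; 12; 0; 6; 11]]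
  | _, _ =>
    [seq mkseq (fun r => if r \in p then k.+1 else 0) 7
       | p <- nth [::] dominating_sets (n - 4)]
  end.

Lemma kroman_number_le_sporadic (n k a b : nat) :
  3 < n < 10 -> k \in [:: 9; 10; 15; 20] ->
  k + 5 <= 5 * a -> k + 3 <= 3 * b + a ->
  ((kroman_number (cart_prod (@cycle_rel 7) (@path_rel n)) k)%:Z
   <= 7 * (n%:Z - 2) * a%:Z + 14 * b%:Z - (n%:Z + 2))%R.
Proof.
move=> n49 k4 ka kb.
pose w := \sum_(c <- sporadic_cols n k) \sum_(x <- c) x.
have wle : (w%:Z <= 7 * (n%:Z - 2) * a%:Z + 14 * b%:Z - (n%:Z + 2))%R.
  rewrite {}/w; move: k4 ka kb; rewrite !inE.
  case: n n49 => [|[|[|[|[|[|[|[|[|[|n]]]]]]]]]] //= _;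
  by move=> /or4P[] /eqP-> ka kb; rewrite unlock /=; lia.
apply: le_trans wle; rewrite lez_nat.
apply: (@kroman_number_le_cols n k w (sporadic_cols n k)) => //.
  rewrite {ka kb}/w; move: k4; rewrite !inE => /or4P[] /eqP->;
  by case: n n49 => [|[|[|[|[|[|[|[|[|[|n]]]]]]]]]] //= _; vm_compute.
move: k4; rewrite !inE => /or4P[] /eqP->;
by case: n n49 {w} => [|[|[|[|[|[|[|[|[|[|n]]]]]]]]]].
Qed.

(** * Integer form of the ceilings, and the case analysis *)

Lemma ceil_div_itv (x d : int) : (0 < d)%R ->
  let c := Num.ceil (x%:~R / d%:~R : rat) in (x <= c * d)%R && (c * d < x + d)%R.
Proof.
move=> d0 /=; set c := Num.ceil _.
have d0' : (0 < d%:~R :> rat)%R by rewrite ltr0z.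
have := ceil_itv (x%:~R / d%:~R : rat)%R; rewrite -/c.
rewrite ltr_pdivlMr // ler_pdivrMr // -!intrM ltr_int ler_int => /andP[h1 h2].
by apply/andP; split; [|move: h1; rewrite mulrBl mul1r ltrBlDr].
Qed.

Local Open Scope ring_scope.

Theorem theorem17 (n k : nat) (hn : (4 <= n)%N) (hk : (1 <= k)%N) :
  (kroman_number (cart_prod (@cycle_rel 7) (@path_rel n)) k)%:Z
  <= 7 * (n%:Z - 2) * Num.ceil ((k%:R + 5) / 5 : rat)
     + 14 * Num.ceil ((k%:R + 3 - (Num.ceil ((k%:R + 5) / 5 : rat))%:~R) / 3
                      : rat)
     - (n%:Z + 2).
Proof.
set A := Num.ceil ((k%:R + 5) / 5 : rat).
have : (k%:Z + 5 <= A * 5) && (A * 5 < k%:Z + 5 + 5).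
  by have := @ceil_div_itv (k%:Z + 5) 5 isT; rewrite intrD.
case: A => [a|//] /andP[a1 a2].
set B := Num.ceil _.
have : (k%:Z + 3 - a%:Z <= B * 3) && (B * 3 < k%:Z + 3 - a%:Z + 3).
  by have := @ceil_div_itv (k%:Z + 3 - a%:Z) 3 isT; rewrite rmorphB rmorphD.
case: B => [b|m] /andP[b1 b2]; last by lia.
have [k5|k6] := leqP k 5.
  have := @kroman_number_le_small n k (ltnW (ltnW hn)).
  move: hk k5 a1 a2 b1 b2.
  (* Here [a = 2] and [b] is 1 or 2, so the target is [13 * n - 30 + 14 * b]. *)
  by case: k => [|[|[|[|[|[|k]]]]]] //; nia.
have ak : (1 < a <= k)%N by lia.
have bk : (1 < b <= k)%N by lia.
have [n9|n10] := ltnP n 10; last first.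
  (* The inequalities for [a] and [b] give [b + 4 * a - k - 4 >= (k + 10) / 15], which exceeds 1 for
     [k >= 6]; hence slack 2. *)
  apply: (@kroman_number_le_perturb_cols n k 4 a b 2 (drift_cols (n - 8))).
  all: try lia.
  - by apply: drift_cols_ok; lia.
  - by rewrite size_drift_cols; lia.
  - by rewrite sum_drift_cols; lia.
have n49 : (3 < n < 10)%N by rewrite hn n9.
have [s3|s3] := leqP (k + 7) (b + 4 * a).
  have [ok sz sm] := perturb_tables_ok n49.
  by apply: kroman_number_le_perturb_cols ok sz sm; lia.
apply: kroman_number_le_sporadic => //; try lia.
(* Slack below 3 forces [(k + 10) / 15 <= 2], hence [k <= 20]; from 6 to 20 only the four listed
   values have it. *)
rewrite !inE; lia.
Qed.
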